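(* Assume $d\geq 2$ and let $A\subseteq\mathbb{R}^d$ be a Lebesgue measurable set with $\delta(A)>0$. Then for all $x\in\mathbb{R}^d$, $$\delta(D_x(A))=\limsup_{R\to\infty}\frac{|D_x(A)\cap(-R,R)|}{R}\geq\frac{\delta(A)}{2|\mathbb{S}^{d-1}|}.$$
   Context: For a Lebesgue measurable set $A\subseteq\mathbb{R}^d$, the upper density is $\delta(A):=\limsup_{R\to\infty}\frac{|B(0,R)\cap A|}{R^d}$, where $B(0,R)$ is the Euclidean ball of radius $R$ centered at the origin in $\mathbb{R}^d$ and $|\cdot|$ of a set denotes Lebesgue measure in $\mathbb{R}^d$ (note the normalization by $R^d$ rather than $|B(0,R)|$). For $x\in\mathbb{R}^d$ and $A\subseteq\mathbb{R}^d$, the pinned distance set is $D_x(A):=\{|x-y| : y\in A\}\subseteq\mathbb{R}$, with $|x-y|$ the Euclidean distance. The upper density $\delta(D_x(A))$ is that of $D_x(A)$ as a subset of $\mathbb{R}$ (the same definition in dimension one), so $|D_x(A)\cap(-R,R)|$ denotes one-dimensional Lebesgue measure. $|\mathbb{S}^{d-1}|$ is the area of the $(d-1)$-dimensional unit sphere in $\mathbb{R}^d$. *)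

(* Defs.v *)
From HB Require Import structures.
From mathcomp Require Import all_boot all_order all_algebra.
From mathcomp Require Import all_classical all_reals all_analysis.

Set Implicit Arguments.
Unset Strict Implicit.
Unset Printing Implicit Defensive.

Import Order.TTheory GRing.Theory Num.Theory.
Import numFieldNormedType.Exports.

Local Open Scope classical_set_scope.
Local Open Scope ring_scope.

(* The library norm on 'rV[R]_d is the sup norm, so the Euclidean norm is
   introduced separately. *)
Definition enorm (R : realType) (d : nat) (x : 'rV[R]_d) : R :=
  Num.sqrt (\sum_(i < d) x ord0 i ^+ 2).

Definition eball (R : realType) (d : nat) (x : 'rV[R]_d) (r : R) :
    set 'rV[R]_d :=
  [set y | enorm (x - y) < r].

(* Half-open, as are the intervals generating [lebesgue_measure] on R. *)
Definition box (R : realType) (d : nat) (a b : 'rV[R]_d) : set 'rV[R]_d :=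
  [set y | forall i, a ord0 i < y ord0 i <= b ord0 i].

(* Lebesgue outer measure on R^d, defined on every subset; it is Lebesgue
   measure on the Lebesgue measurable sets.  Likewise, the library's
   [lebesgue_measure] on R is the outer measure when evaluated at an arbitrary
   set. *)
Definition lebesgue_outer (R : realType) (d : nat) (E : set 'rV[R]_d) :
    \bar R :=
  ereal_inf [set s : \bar R | exists a b : nat -> 'rV[R]_d,
    [/\ forall k i, a k ord0 i <= b k ord0 i,
        E `<=` \bigcup_k box (a k) (b k) &
        s = (\sum_(k <oo) (\prod_(i < d) (b k ord0 i - a k ord0 i))%:E)%E]].

Definition lebesgue_measurable (R : realType) (d : nat) (A : set 'rV[R]_d) :
    Prop :=
  (@lebesgue_outer R d).-caratheodory A.

Definition upper_density (R : realType) (d : nat) (A : set 'rV[R]_d) :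
    \bar R :=
  limf_esup
    (fun r : R => (lebesgue_outer (eball 0 r `&` A) / (r ^+ d)%:E)%E)
    (pinfty_nbhs R).

Definition pinned_distance_set (R : realType) (d : nat) (x : 'rV[R]_d)
    (A : set 'rV[R]_d) : set R :=
  [set enorm (x - y) | y in A].

(* A subset of R regarded as a subset of R^1. *)
Definition embed_R1 (R : realType) (D : set R) : set 'rV[R]_1 :=
  [set t | D (t ord0 ord0)].

(* Area of a hypersurface S of R^d, as its (d-1)-dimensional Minkowski content:
   the volume of the open e-neighbourhood of S, divided by its thickness 2e, in
   the limit e -> 0+.  For compact C^1 hypersurfaces the limit exists and is the
   usual surface area. *)
Definition surface_area (R : realType) (d : nat) (S : set 'rV[R]_d) :
    \bar R :=
  lim ((lebesgue_outer (\bigcup_(y in S) eball y e) / (2 * e)%:E)%E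
         @[e --> 0^'+]).

Definition unit_sphere (R : realType) (d : nat) : set 'rV[R]_d :=
  [set x | enorm x = 1].

Arguments unit_sphere : clear implicits.

(* Main.v *)
Require Import Defs.
From HB Require Import structures.
From mathcomp Require Import all_boot all_order all_algebra.
From mathcomp Require Import all_classical all_reals all_analysis.
From mathcomp Require Import ring lra.
Import Order.TTheory GRing.Theory Num.Theory.
Import numFieldNormedType.Exports.
Local Open Scope classical_set_scope.
Local Open Scope ring_scope.

(** Let V(a,b) be the outer measure of the closed spherical shell
    a <= |y| <= b of R^d.  The points of A in the ball B(0,r) are at distances
    from x which lie in D_x(A) and are less than r + |x|.  A covering of
    D_x(A) `&` [0, r + |x|[ by intervals of total length l thus yields a
    covering of A `&` B(0,r) by shells centred at x.  Since
    V(a,b) <= S * R^(d-1) * (b-a) for 0 <= a <= b <= R, where S is the area of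
    the unit sphere, this gives
      |A `&` B(0,r)| <= S * (r + |x|)^(d-1) * |D_x(A) `&` [0, r + |x|[ |.
    Dividing by r^d and passing to the upper limit proves the inequality; the
    factor 2 absorbs ((r + |x|) / r)^d, which tends to 1.

    The link between S and V is made without computing the volume of a ball and
    without the additivity of Lebesgue measure: only countable subadditivity
    and d-homogeneity, V(ta,tb) = t^d V(a,b), are used.  Let K be the supremum
    of the quotients V(a,b) / (b^d - a^d).  A lower bound k for one shell
    passes to all sufficiently thin shells around the unit sphere: were the
    quotient of such a shell at most k, its homothetic copies, stacked in
    geometric progression, would make every quotient at most k, up to an error
    that vanishes with the thickness ([shell_dissection]).  This is the
    argument of Fekete's lemma.
    The quotient of the shell [1-e, 1+e] therefore tends to K, so that the
    Minkowski content defining S converges to d * K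
    ([surface_area_unit_sphere]), while V(a,b) <= K (b^d - a^d) holds by the
    choice of K.  An infinite K would make the claimed lower bound zero, and
    K = 0 would contradict the positivity of the upper density of A. *)

(** * Lebesgue outer measure *)

Section outer_measure.
Context {R : realType}.

Definition box_vol (d : nat) (a b : 'rV[R]_d) : R :=
  \prod_(i < d) (b ord0 i - a ord0 i).

Lemma box_vol_ge0 (d : nat) (a b : 'rV[R]_d) :
  (forall i, a ord0 i <= b ord0 i) -> 0 <= box_vol d a b.
Proof. by move=> ab; apply: prodr_ge0 => i _; rewrite subr_ge0. Qed.

Lemma lebesgue_outer_le_cover (d : nat) (E : set 'rV[R]_d)
    (a b : nat -> 'rV[R]_d) :
  (forall k i, a k ord0 i <= b k ord0 i) ->
  E `<=` \bigcup_k box (a k) (b k) ->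
  (lebesgue_outer E <= \sum_(k <oo) (box_vol d (a k) (b k))%:E)%E.
Proof. by move=> ab EB; apply: ereal_inf_lbound; exists a, b. Qed.

Lemma lebesgue_outer_ltP (d : nat) (E : set 'rV[R]_d) (s : \bar R) :
  (lebesgue_outer E < s)%E ->
  exists a b : nat -> 'rV[R]_d,
    [/\ forall k i, a k ord0 i <= b k ord0 i,
        E `<=` \bigcup_k box (a k) (b k) &
        (\sum_(k <oo) (box_vol d (a k) (b k))%:E < s)%E].
Proof.
by move=> /ereal_inf_lt[_ [a [b [ab EB ->]]] lts]; exists a, b.
Qed.

Lemma lebesgue_outer_ge0 (d : nat) (E : set 'rV[R]_d) :
  (0 <= lebesgue_outer E)%E.
Proof.
apply: le_ereal_inf_tmp => _ [a [b [ab _ ->]]].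
by apply: nneseries_ge0 => k _ _; rewrite lee_fin box_vol_ge0.
Qed.

Lemma le_lebesgue_outer (d : nat) :
  {homo @lebesgue_outer R d : E F / E `<=` F >-> (E <= F)%E}.
Proof.
move=> E F EF; apply: ereal_inf_le_tmp => _ [a [b [ab FB ->]]].
by exists a, b; split => //; exact: subset_trans FB.
Qed.

Lemma lebesgue_outer0 (n : nat) : @lebesgue_outer R n.+1 set0 = 0%E.
Proof.
apply/eqP; rewrite eq_le lebesgue_outer_ge0 andbT.
apply: le_trans (@lebesgue_outer_le_cover _ _ (fun=> 0) (fun=> 0) _ _) _ => //.
rewrite eseries0// => k _ _; rewrite /box_vol.
by rewrite (bigD1 ord0)//= subrr mul0r.
Qed.

Lemma lebesgue_outer_sigma_subadditive (n : nat) :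
  sigma_subadditive (@lebesgue_outer R n.+1).
Proof.
move=> F.
have [[i Foo]|Ffin] := pselect (exists i, lebesgue_outer (F i) = +oo%E).
  rewrite (eseries_pinfty _ _ Foo) ?leey// => k _.
  by rewrite -ltNye (lt_le_trans _ (lebesgue_outer_ge0 _ _)).
apply/lee_addgt0Pr => e e0.
apply: le_trans (epsilon_trick xpredT _ (ltW e0)); last first.
  by move=> k; exact: lebesgue_outer_ge0.
pose cover k (g : (nat -> 'rV[R]_n.+1) * (nat -> 'rV[R]_n.+1)) :=
  [/\ forall j i, g.1 j ord0 i <= g.2 j ord0 i,
      F k `<=` \bigcup_j box (g.1 j) (g.2 j) &
      (\sum_(j <oo) (box_vol n.+1 (g.1 j) (g.2 j))%:E
        <= lebesgue_outer (F k) + (e / (2 ^ k.+1)%:R)%:E)%E].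
have [g gP] : {g & forall k, cover k (g k)}.
  apply: (@choice _ _ cover) => k.
  have : (lebesgue_outer (F k) <
          lebesgue_outer (F k) + (e / (2 ^ k.+1)%:R)%:E)%E.
    rewrite lteDl ?lte_fin ?divr_gt0 ?ltr0n ?expn_gt0//.
    rewrite ge0_fin_numE ?lebesgue_outer_ge0// lt_neqAle leey andbT.
    by apply/eqP => Foo; apply: Ffin; exists k.
  by move=> /lebesgue_outer_ltP[a [b [ab FB /ltW lts]]]; exists (a, b).
(* All the boxes of all the coverings are listed as a single sequence. *)
have /card_esym/ppcard_eqP[f] := card_nat2.
pose v (p : nat * nat) := (box_vol n.+1 ((g p.1).1 p.2) ((g p.1).2 p.2))%:E.
have v0 p : (0 <= v p)%E by rewrite lee_fin box_vol_ge0//; case: (gP p.1).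
apply: (@le_trans _ _ (\sum_(k <oo) v (f k))%E).
  apply: lebesgue_outer_le_cover => [k i|]; first by case: (gP (f k).1).
  move=> y [k _ Fky]; have [_ /(_ y Fky)[j _ yj] _] := gP k.
  by exists (f^-1%FUN (k, j)) => //=; rewrite invK ?inE.
have -> : (\sum_(k <oo) v (f k) = \sum_(k <oo) \sum_(j <oo) v (k, j))%E.
  rewrite nneseries_esum//.
  rewrite -(@reindex_esum R _ _ _ [set: nat * nat] f v); last first.
    by rewrite set_true; exact: bij.
  rewrite (_ : esum _ v = \esum_(p in setT `*`` (fun=> setT)) v (p.1, p.2))%E.
    rewrite -(@esum_esum _ _ _ _ _ (fun k j => v (k, j)))//.
    rewrite nneseries_esum; last by move=> k _; exact: nneseries_ge0.
    rewrite set_true; apply: eq_esum => k _.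
    by rewrite nneseries_esum// set_true.
  rewrite (_ : setT `*`` _ = setT); last by apply/seteqP.
  by apply: eq_esum => -[].
apply: lee_nneseries => [k _ _|k _]; first exact: nneseries_ge0.
by case: (gP k).
Qed.

(** The dimension is a successor because in dimension 0 the only box is the
    whole space, of volume 1, so that the empty set has infinite outer
    measure. *)
HB.instance Definition _ (n : nat) := isOuterMeasure.Build R 'rV[R]_n.+1
  (@lebesgue_outer R n.+1) (lebesgue_outer0 n) (@lebesgue_outer_ge0 n.+1)
  (@le_lebesgue_outer n.+1) (@lebesgue_outer_sigma_subadditive n).

(** Translations and homotheties in one statement; [E] need only be contained
    in the image of [F] under y |-> t y + x, a map which sends boxes to
    boxes. *)
Lemma lebesgue_outer_affine (d : nat) (t : R) (x : 'rV[R]_d)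
    (E F : set 'rV[R]_d) :
  0 < t -> (forall y, E (t *: y + x) -> F y) ->
  (lebesgue_outer E <= (t ^+ d)%:E * lebesgue_outer F)%E.
Proof.
move=> t0 EF; rewrite muleC -lee_pdivrMr ?exprn_gt0//.
apply: le_ereal_inf_tmp => _ [a [b [ab FB ->]]].
rewrite lee_pdivrMr ?exprn_gt0// muleC.
rewrite -nneseriesZl; last by move=> k _; rewrite lee_fin box_vol_ge0.
rewrite [leRHS](_ : _ =
    \sum_(k <oo) (box_vol d (t *: a k + x) (t *: b k + x))%:E)%E; last first.
  apply: eq_eseriesr => k _; rewrite -EFinM; congr EFin.
  rewrite -[X in t ^+ X](card_ord d) -prodr_const -big_split/=.
  by apply: eq_bigr => i _; rewrite !mxE; ring.
apply: lebesgue_outer_le_cover => [k i|y Ey].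
  by rewrite !mxE lerD2r ler_pM2l.
have : F (t^-1 *: (y - x)).
  by apply: EF; rewrite scalerA divff ?gt_eqF// scale1r subrK.
move=> /FB[k _ yk]; exists k => // i; have := yk i.
rewrite !mxE mulrC ltr_pdivlMr// ler_pdivrMr// => /andP[aty ytb].
by apply/andP; split; lra.
Qed.

End outer_measure.

Section real_line.
Context {R : realType}.

(** Both sides are infima over coverings by half-open intervals; only the
    presentation of the coverings differs. *)
Lemma lebesgue_outer_embed_R1 (E : set R) :
  lebesgue_outer (embed_R1 E) = lebesgue_measure E.
Proof.
have wlengthE (a b : R) : a <= b ->
    wlength (@idfun R) `]a, b]%classic = (b - a)%:E.
  exact: (@wlength_itv_bnd _ idfun a b false false).
apply/eqP; rewrite eq_le; apply/andP; split.
- apply: le_ereal_inf_tmp => _ [I [mI EI] <-].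
  have [p pP] : {p : nat -> R * R & forall k,
      (p k).1 <= (p k).2 /\ I k = `](p k).1, (p k).2]%classic}.
    apply: (@choice _ _ (fun k (p : R * R) =>
      p.1 <= p.2 /\ I k = `]p.1, p.2]%classic)) => k.
    have [-> | [p /ltW p12 Ip]] := (ocitvP _).1 (mI k); last by exists p.
    by exists (0, 0); rewrite /= set_itvoc0.
  rewrite [leRHS](_ : _ = \sum_(k <oo)
      (box_vol 1 (const_mx (p k).1) (const_mx (p k).2))%:E)%E; last first.
    apply: eq_eseriesr => k _; have [p12 ->] := pP k.
    by apply: etrans (wlengthE _ _ p12) _; rewrite /box_vol big_ord1 !mxE.
  apply: lebesgue_outer_le_cover => [k i|y /EI[k _ Iy]].
    by rewrite !mxE; case: (pP k).
  exists k => // i; rewrite !mxE (ord1 i).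
  by move: Iy; rewrite (pP k).2 /= in_itv.
- apply: le_ereal_inf_tmp => _ [a [b [ab EB ->]]]; apply: ereal_inf_lbound.
  exists (fun k => `]a k ord0 ord0, b k ord0 ord0]%classic).
    split=> [k|y Ey]; first exact: is_ocitv.
    have /EB[k _ yk] : embed_R1 E (const_mx y) by rewrite /embed_R1 /= mxE.
    by exists k => //=; have := yk ord0; rewrite mxE in_itv.
  apply: eq_eseriesr => k _; rewrite big_ord1.
  by apply: wlengthE; exact: ab.
Qed.

End real_line.

(** * The Euclidean norm *)

Section euclidean_norm.
Context {R : realType} {d : nat}.
Implicit Types x y : 'rV[R]_d.

Lemma enorm_ge0 x : 0 <= enorm x.
Proof. exact: sqrtr_ge0. Qed.

Lemma sqr_enorm x : enorm x ^+ 2 = \sum_(i < d) x ord0 i ^+ 2.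
Proof. by rewrite sqr_sqrtr// sumr_ge0// => i _; exact: sqr_ge0. Qed.

Lemma enormZ t x : enorm (t *: x) = `|t| * enorm x.
Proof.
rewrite /enorm -sqrtr_sqr -sqrtrM ?sqr_ge0// mulr_sumr.
by congr Num.sqrt; apply: eq_bigr => i _; rewrite mxE exprMn.
Qed.

Lemma enormN x : enorm (- x) = enorm x.
Proof. by rewrite -scaleN1r enormZ normrN1 mul1r. Qed.

Lemma enormB x y : enorm (x - y) = enorm (y - x).
Proof. by rewrite -opprB enormN. Qed.

Lemma ler_coord_enorm x i : `|x ord0 i| <= enorm x.
Proof.
rewrite -ler_sqr ?nnegrE ?enorm_ge0// sqr_enorm.
rewrite (bigD1 i)//= real_normK ?num_real//.
by rewrite lerDl sumr_ge0// => j _; exact: sqr_ge0.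
Qed.

Lemma enorm_eq0 x : enorm x = 0 -> x = 0.
Proof.
move=> x0; apply/rowP => i; rewrite mxE; apply/eqP.
by rewrite -normr_le0 -x0 ler_coord_enorm.
Qed.

Lemma enorm_cauchy_schwarz x y :
  \sum_(i < d) x ord0 i * y ord0 i <= enorm x * enorm y.
Proof.
have [/enorm_eq0->|/eqP x0] := eqVneq (enorm x) 0.
  rewrite big1 ?mulr_ge0 ?enorm_ge0// => i _.
  by rewrite mxE mul0r.
have [/enorm_eq0->|/eqP y0] := eqVneq (enorm y) 0.
  rewrite big1 ?mulr_ge0 ?enorm_ge0// => i _.
  by rewrite mxE mulr0.
have xy0 : 0 < enorm x * enorm y.
  by rewrite mulr_gt0// lt_def enorm_ge0 andbT; apply/eqP.
(* Summing 2uv <= u^2 + v^2 with u = |y| x_i and v = |x| y_i gives the claim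
   multiplied by |x||y|. *)
rewrite -(ler_pM2l xy0) mulr_sumr.
rewrite [leRHS](_ : _ = \sum_(i < d) ((enorm y * x ord0 i) ^+ 2
    + (enorm x * y ord0 i) ^+ 2) / 2); last first.
  rewrite -mulr_suml big_split/=.
  under eq_bigr do rewrite exprMn.
  under [X in _ + X]eq_bigr do rewrite exprMn.
  by rewrite -!mulr_sumr -!sqr_enorm; field.
apply: ler_sum => i _.
have := sqr_ge0 (enorm y * x ord0 i - enorm x * y ord0 i).
by nra.
Qed.

Lemma ler_enormD x y : enorm (x + y) <= enorm x + enorm y.
Proof.
rewrite -ler_sqr ?nnegrE ?addr_ge0 ?enorm_ge0//.
rewrite sqrrD !sqr_enorm.
under eq_bigr do rewrite mxE sqrrD.
rewrite !big_split/= lerD2r lerD2l -mulr2n lerMn2r/=.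
exact: enorm_cauchy_schwarz.
Qed.

End euclidean_norm.

(** * Real analysis *)

Lemma cvg_exprn {R : realType} {T : Type} (F : set_system T) (FF : Filter F)
    (f : T -> R) (l : R) (n : nat) :
  f t @[t --> F] --> l -> f t ^+ n @[t --> F] --> l ^+ n.
Proof.
by move=> fl; exact: (continuous_cvg _ (@exprn_continuous _ n l) fl).
Qed.

Lemma unbounded_expr {R : realType} (p x : R) : 1 < p -> exists j, x <= p ^+ j.
Proof.
move=> p1; have bernoulli j : 1 + j%:R * (p - 1) <= p ^+ j.
  elim: j => [|j IH]; first by rewrite mul0r addr0 expr0.
  rewrite exprS -natr1; have := ler_wpM2l (ltW (lt_trans ltr01 p1)) IH.
  apply: le_trans; have := mulr_ge0 (ler0n R j) (sqr_ge0 (p - 1)).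
  by nra.
exists (Num.truncn (x / (p - 1))).+1; apply: le_trans (bernoulli _).
have p10 : 0 < p - 1 by rewrite subr_gt0.
have /ltW := truncnS_gt (x / (p - 1)).
by rewrite ler_pdivrMr//; lra.
Qed.

Lemma exprB_bounds {R : realDomainType} (a b : R) (n : nat) :
  0 <= a -> a <= b ->
  n.+1%:R * a ^+ n * (b - a) <= b ^+ n.+1 - a ^+ n.+1 <=
  n.+1%:R * b ^+ n * (b - a).
Proof.
move=> a0 ab; rewrite subrXX ![(b - a) * _]mulrC.
have b0 := le_trans a0 ab.
have sum_const (c : R) : n.+1%:R * c = \sum_(i < n.+1) c.
  by rewrite sumr_const card_ord mulr_natl.
apply/andP; split; rewrite ler_wpM2r ?subr_ge0// sum_const.
  apply: ler_sum => i _ /=.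
  have -> : a ^+ n = a ^+ (n - i) * a ^+ i by rewrite -exprD subnK ?leq_ord.
  by rewrite ler_wpM2r ?exprn_ge0// lerXn2r ?nnegrE.
apply: ler_sum => i _ /=.
have -> : b ^+ n = b ^+ (n - i) * b ^+ i by rewrite -exprD subnK ?leq_ord.
by rewrite ler_wpM2l ?exprn_ge0// lerXn2r ?nnegrE.
Qed.

Lemma exprB_gt0 {R : realDomainType} (a b : R) (n : nat) :
  0 <= a -> a < b -> 0 < b ^+ n.+1 - a ^+ n.+1.
Proof. by move=> a0 ab; rewrite subr_gt0 ltrXn2r. Qed.

Lemma cvge_real_bounds {R : realType} {T : Type} {F : set_system T}
    {FF : Filter F} (f : T -> \bar R) (S : \bar R) : (S != -oo)%E ->
  (forall s : R, (s%:E < S)%E -> \forall e \near F, (s%:E <= f e)%E) ->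
  (forall s : R, (S < s%:E)%E -> \forall e \near F, (f e <= s%:E)%E) ->
  f e @[e --> F] --> S.
Proof.
case: S => [S _ lo up|_ lo _|//].
  have cvgF : fine (f e) @[e --> F] --> S.
    apply/cvgrPdist_le => eps eps0; near=> e.
    have : ((S - eps)%:E <= f e)%E.
      by near: e; apply: lo; rewrite lte_fin ltrBlDr ltrDl.
    have : (f e <= (S + eps)%:E)%E.
      by near: e; apply: up; rewrite lte_fin ltrDl.
    case: (f e) => [r| |]//=; rewrite !lee_fin => ? ?.
    by rewrite ler_norml; apply/andP; split; lra.
  apply: cvg_EFin => //; near=> e.
  have : ((S - 1)%:E <= f e)%E.
    by near: e; apply: lo; rewrite lte_fin ltrBlDr ltrDl.
  have : (f e <= (S + 1)%:E)%E.
    by near: e; apply: up; rewrite lte_fin ltrDl.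
  by case: (f e).
by apply/cvgeyPge => s; apply: lo; exact: ltry.
Unshelve. all: by end_near. Qed.

(** * Volumes of spherical shells *)

Section shells.
Context {R : realType} {n : nat}.

Definition shell (a b : R) : set 'rV[R]_n.+1 := [set y | a <= enorm y <= b].

Lemma shell_fin_num a b : lebesgue_outer (shell a b) \is a fin_num.
Proof.
rewrite ge0_fin_numE ?lebesgue_outer_ge0//.
pose corner (t : R) (k : nat) : 'rV[R]_n.+1 := if k is 0 then const_mx t else 0.
apply: (@le_lt_trans _ _ (\sum_(k <oo)
    (box_vol n.+1 (corner (- `|b| - 1) k) (corner `|b| k))%:E)%E).
  (* The lower corner is moved down because boxes do not contain their lower
     faces. *)
  apply: lebesgue_outer_le_cover => [[|k] i|y]; rewrite /shell/=.
  - by rewrite !mxE; have := normr_ge0 b; lra.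
  - by rewrite /= mxE.
  - move=> /andP[_ yb]; exists 0%N => // i; rewrite /= !mxE.
    have := ler_coord_enorm y i; rewrite ler_norml => /andP[yi1 yi2].
    have b_le := ler_norm b.
    by apply/andP; split; lra.
rewrite nneseries_recl//; last first.
  move=> [|k] _; rewrite lee_fin box_vol_ge0// => i; rewrite !mxE//.
  by have := normr_ge0 b; lra.
rewrite eseries0 ?adde0 ?ltry// => -[|k]// _ _.
by rewrite /box_vol (bigD1 ord0)//= subrr mul0r.
Qed.

Lemma shellZ t a b : 0 < t ->
  lebesgue_outer (shell (t * a) (t * b)) =
  ((t ^+ n.+1)%:E * lebesgue_outer (shell a b))%E.
Proof.
(* The reverse inequality is this one for the inverse homothety. *)
have le_shellZ u v w : 0 < u -> (lebesgue_outer (shell (u * v) (u * w)) <=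
    (u ^+ n.+1)%:E * lebesgue_outer (shell v w))%E.
  move=> u0; apply: (@lebesgue_outer_affine _ _ u 0) => // y.
  by rewrite addr0 /shell /= enormZ gtr0_norm// !ler_pM2l.
move=> t0; apply/eqP; rewrite eq_le le_shellZ//= -lee_pdivlMl ?exprn_gt0//.
have := @le_shellZ t^-1 (t * a) (t * b); rewrite !mulKf ?gt_eqF// exprVn.
by apply; rewrite invr_gt0.
Qed.

Lemma shell_subadditive a b c :
  (lebesgue_outer (shell a c) <=
   lebesgue_outer (shell a b) + lebesgue_outer (shell b c))%E.
Proof.
apply: le_trans (outer_measureU2 _ _ _); apply: le_lebesgue_outer => y.
rewrite /shell/=.
move=> /andP[ay yc]; have [yb|/ltW by_] := leP (enorm y) b.
  by left; rewrite /shell/= ay.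
by right; rewrite /shell/= by_.
Qed.

Lemma le_shell a b a' b' : a' <= a -> b <= b' ->
  (lebesgue_outer (shell a b) <= lebesgue_outer (shell a' b'))%E.
Proof.
move=> aa bb; apply: le_lebesgue_outer => y; rewrite /shell/= => /andP[ay yb].
by rewrite (le_trans aa ay) (le_trans yb bb).
Qed.

(** The homothetic copies a p^j [1, p] of the thin shell, with
    p = (1 + e) / (1 - e), cover the shell [a, b]; their bounds telescope
    because both sides are d-homogeneous.  The last copy may stick out of
    [a, b], by a factor at most p. *)
Lemma shell_dissection (k e a b : R) :
  0 <= k -> 0 < e -> e < 1 -> 0 < a -> a < b ->
  (lebesgue_outer (shell (1 - e) (1 + e)) <=
   (k * ((1 + e) ^+ n.+1 - (1 - e) ^+ n.+1))%:E)%E ->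
  (lebesgue_outer (shell a b) <=
   (k * ((b * ((1 + e) / (1 - e))) ^+ n.+1 - a ^+ n.+1))%:E)%E.
Proof.
move=> k0 e0 e1 a0 ab thin; set p := (1 + e) / (1 - e).
have e1' : 0 < 1 - e by rewrite subr_gt0.
have p1 : 1 < p by rewrite ltr_pdivlMr//; lra.
have p0 : 0 < p by exact: lt_trans p1.
have step c : 0 < c -> (lebesgue_outer (shell c (c * p)) <=
    (k * ((c * p) ^+ n.+1 - c ^+ n.+1))%:E)%E.
  have [t ->] : exists t, c = t * (1 - e).
    by exists (c / (1 - e)); rewrite divfK ?gt_eqF.
  rewrite pmulr_lgt0// => t0.
  have -> : t * (1 - e) * p = t * (1 + e) by rewrite /p; field; rewrite gt_eqF.
  rewrite shellZ//; apply: (le_trans (lee_wpmul2l _ thin)).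
    by rewrite lee_fin exprn_ge0// ltW.
  by rewrite -EFinM !exprMn lee_fin; lra.
have ladder j : (lebesgue_outer (shell a (a * p ^+ j.+1)) <=
    (k * ((a * p ^+ j.+1) ^+ n.+1 - a ^+ n.+1))%:E)%E.
  elim: j => [|j IH]; first by rewrite expr1 step.
  rewrite [p ^+ j.+2]exprSr mulrA.
  apply: le_trans (shell_subadditive _ (a * p ^+ j.+1) _) _.
  apply: (le_trans (leeD IH (step _ _))); first by rewrite mulr_gt0// exprn_gt0.
  by rewrite -EFinD lee_fin; lra.
have exj : exists j, b <= a * p ^+ j.
  have [j] := unbounded_expr p (b / a) p1.
  by rewrite ler_pdivrMr// mulrC; exists j.
case: (ex_minnP exj) => -[|i] bi imin.
  by move: bi; rewrite expr0 mulr1 leNgt ab.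
have pib : a * p ^+ i < b.
  by rewrite ltNge; apply/negP => /imin; rewrite ltnn.
apply: (le_trans (le_shell _ _ _ _ (lexx a) bi)); apply: (le_trans (ladder i)).
rewrite lee_fin ler_wpM2l// lerD2r; apply: lerXn2r; rewrite ?nnegrE.
- by rewrite mulr_ge0// ?exprn_ge0// ltW.
- by rewrite mulr_ge0// ltW//; exact: lt_trans ab.
- by rewrite exprSr mulrA ler_wpM2r// ltW.
Qed.

(** This is the volume of the unit ball.  As a supremum it is bounded below by
    every single shell, which is what the Fekete argument needs; it is left in
    the extended reals since its finiteness does not follow from
    subadditivity alone. *)
Definition shell_density : \bar R :=
  ereal_sup [set (lebesgue_outer (shell ab.1 ab.2) *
                  ((ab.2 ^+ n.+1 - ab.1 ^+ n.+1)^-1)%:E)%E |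
             ab in [set ab : R * R | 0 < ab.1 < ab.2]].

Lemma shell_le_density K a b : shell_density = K%:E -> 0 < a -> a < b ->
  (lebesgue_outer (shell a b) <= (K * (b ^+ n.+1 - a ^+ n.+1))%:E)%E.
Proof.
move=> KE a0 ab; rewrite EFinM -lee_pdivrMr ?exprB_gt0 ?(ltW a0)// -KE.
by apply: ereal_sup_ubound; exists (a, b) => //=; rewrite a0.
Qed.

Lemma shell_density_ge0 : (0 <= shell_density)%E.
Proof.
apply: le_ereal_sup_tmp; exists (lebesgue_outer (shell 1 2) *
    ((2 ^+ n.+1 - 1 ^+ n.+1)^-1)%:E)%E.
  by exists (1, 2) => //=; rewrite ltr01 ltr1n.
rewrite mule_ge0 ?lebesgue_outer_ge0// lee_fin invr_ge0.
by rewrite ltW// exprB_gt0// ltr1n.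
Qed.

(** If a thin shell failed the bound, dissecting into its copies a shell [a, b]
    whose quotient exceeds [k] would bound that quotient by [k] in the limit. *)
Lemma near_thin_shell_ge (k : R) : 0 <= k -> (k%:E < shell_density)%E ->
  \forall e \near 0^'+, ((k * ((1 + e) ^+ n.+1 - (1 - e) ^+ n.+1))%:E <=
    lebesgue_outer (shell (1 - e) (1 + e)))%E.
Proof.
move=> k0 /ereal_sup_gt[_ [[a b] /= /andP[a0 ab] <-]].
rewrite lte_pdivlMr ?exprB_gt0 ?(ltW a0)//.
have /fineK <- := shell_fin_num a b; set v := fine _.
rewrite -EFinM lte_fin => kv.
have cvg_dissection : (k * ((b * ((1 + e) / (1 - e))) ^+ n.+1 - a ^+ n.+1))
    @[e --> 0^'+] --> k * (b ^+ n.+1 - a ^+ n.+1).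
  have ratio : b * ((1 + e) / (1 - e)) @[e --> 0^'+] --> b.
    rewrite [X in _ --> X](_ : b = b * ((1 + 0) / (1 - 0))); last first.
      by rewrite addr0 subr0 divr1 mulr1.
    apply: cvg_at_right_filter; apply: cvgM; first exact: cvg_cst.
    apply: cvgM; first by apply: cvgD; [exact: cvg_cst|exact: cvg_id].
    apply: cvgV; first by rewrite subr0 oner_neq0.
    by apply: cvgB; [exact: cvg_cst|exact: cvg_id].
  apply: cvgM; first exact: cvg_cst.
  by apply: cvgB; [exact: cvg_exprn|exact: cvg_cst].
near=> e; rewrite leNgt; apply/negP => /ltW thin.
have e0 : 0 < e by near: e; exact: nbhs_right_gt.
have e1 : e < 1 by near: e; exact: nbhs_right_lt.
have := shell_dissection k e a b k0 e0 e1 a0 ab thin.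
have /fineK <- := shell_fin_num a b; rewrite lee_fin.
apply/negP; rewrite -ltNge.
by near: e; apply: cvgr_lt cvg_dissection _ kv.
Unshelve. all: by end_near. Qed.

Lemma le_nbhd_shell (e : R) :
  (lebesgue_outer (\bigcup_(y in unit_sphere R n.+1) eball y e) <=
   lebesgue_outer (shell (1 - e) (1 + e)))%E.
Proof.
apply: le_lebesgue_outer => z [y y1 /= /ltW yz]; rewrite /shell/=.
have := ler_enormD (y - z) z; rewrite subrK y1 => ?.
have := ler_enormD (z - y) y; rewrite subrK y1 enormB => ?.
by move: yz; rewrite /eball /= => ?; apply/andP; split; lra.
Qed.

(** The radial projection z / |z| is the nearest point of the unit sphere.  The
    strict inequality accounts for the shell being closed and the
    neighbourhood open. *)
Lemma ge_nbhd_shell (e' e : R) : 0 < e' -> e' < 1 -> e' < e ->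
  (lebesgue_outer (shell (1 - e') (1 + e')) <=
   lebesgue_outer (\bigcup_(y in unit_sphere R n.+1) eball y e))%E.
Proof.
move=> e'0 e'1 e'e; apply: le_lebesgue_outer => z; rewrite /shell/=.
move=> /andP[z1 z2]; have z0 : 0 < enorm z by lra.
exists ((enorm z)^-1 *: z).
  by rewrite /unit_sphere/= enormZ gtr0_norm ?invr_gt0// mulVf// gt_eqF.
rewrite /eball/= -[X in _ - X]scale1r -scalerBl enormZ.
apply: le_lt_trans e'e; rewrite -{2}(ger0_norm (ltW z0)) -normrM.
by rewrite mulrBl mulVf ?gt_eqF// mul1r ler_norml; apply/andP; split; lra.
Qed.

(** The e-neighbourhood of the sphere is the shell [1-e, 1+e] up to its
    boundary, and ((1+e)^d - (1-e)^d) / 2e tends to d. *)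
Lemma surface_area_unit_sphere :
  surface_area (unit_sphere R n.+1) = (n.+1%:R%:E * shell_density)%E.
Proof.
apply: cvg_lim => //.
have d0 : 0 < n.+1%:R :> R by rewrite ltr0n.
have dens0 := shell_density_ge0.
apply: cvge_real_bounds => [|s|s].
- by rewrite gt_eqF// (lt_le_trans ltNy0)// mule_ge0// lee_fin ltW.
- rewrite muleC -lte_pdivrMr// -EFinM => s_lt.
  have [s0|s0] := ltP s 0.
    near=> e; rewrite (@le_trans _ _ 0%E) ?lee_fin ?(ltW s0)//.
    rewrite mule_ge0 ?lebesgue_outer_ge0// inve_ge0 lee_fin.
    by rewrite mulr_ge0//; near: e; exact: nbhs_right_ge.
  have [k /andP[sk kdens]] : exists k : R,
      (s / n.+1%:R < k) && (k%:E < shell_density)%E.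
    case: shell_density s_lt => [K| |]// s_lt.
      exists ((s / n.+1%:R + K) / 2); move: s_lt; rewrite !lte_fin => sK.
      by rewrite !midf_lt.
    by exists (s / n.+1%:R + 1); rewrite ltrDl ltr01 ltry.
  have k0 : 0 <= k by apply: le_trans (ltW sk); rewrite divr_ge0// ltW.
  have [r /= r0 near_k] := near_thin_shell_ge k k0 kdens.
  have lim_lo : k * n.+1%:R * (1 - e) ^+ n.+1 @[e --> 0^'+] --> k * n.+1%:R.
    rewrite [X in _ --> X](_ : _ = k * n.+1%:R * (1 - 0) ^+ n.+1); last first.
      by rewrite subr0 expr1n mulr1.
    apply: cvg_at_right_filter; apply: cvgM; first exact: cvg_cst.
    by apply: cvg_exprn; apply: cvgB; [exact: cvg_cst|exact: cvg_id].
  near=> e.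
  have e0 : 0 < e by near: e; exact: nbhs_right_gt.
  have e1 : e < 1 by near: e; exact: nbhs_right_lt.
  have er : e < r by near: e; exact: nbhs_right_lt.
  have s_le : s <= k * n.+1%:R * (1 - e) ^+ n.+1.
    near: e; apply: cvgr_ge lim_lo _ _.
    by rewrite -ltr_pdivrMr.
  (* The closed shell of half-width e (1 - e) fits in the open neighbourhood of
     half-width e, and the ratio of the widths tends to 1. *)
  have e'0 : 0 < e * (1 - e) by rewrite mulr_gt0// subr_gt0.
  have e'e : e * (1 - e) < e by rewrite gtr_pMr// ltrBlDr ltrDl.
  rewrite inver gt_eqF ?mulr_gt0// lee_pdivlMr ?mulr_gt0//.
  apply: le_trans (ge_nbhd_shell _ _ e'0 (lt_trans e'e e1) e'e).
  apply: le_trans (near_k _ _ e'0); last first.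
    by rewrite /ball_/= sub0r normrN gtr0_norm// (lt_trans e'e).
  rewrite -EFinM lee_fin.
  set e' := e * (1 - e) in e'0 e'e *.
  have /andP[gap _] := @exprB_bounds _ (1 - e') (1 + e') n
    ltac:(rewrite subr_ge0; lra) ltac:(lra).
  apply: le_trans (ler_wpM2l k0 gap).
  apply: (@le_trans _ _ (k * n.+1%:R * (1 - e) ^+ n.+1 * (2 * e))).
    by rewrite ler_wpM2r// mulr_ge0// ltW.
  rewrite [leLHS](_ : _ = k * (n.+1%:R * (1 - e) ^+ n * (2 * e'))); last first.
    by rewrite exprS /e'; ring.
  apply: ler_wpM2l => //; have -> : 1 + e' - (1 - e') = 2 * e' by ring.
  apply: ler_wpM2r; first by rewrite mulr_ge0// ltW.
  by apply: ler_wpM2l => //; apply: lerXn2r; rewrite ?nnegrE; lra.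
- move=> dens_lt; have [K KE] : exists K, shell_density = K%:E.
    case: shell_density dens0 dens_lt => [K| |]//; first by exists K.
    by rewrite gt0_muley ?lte_fin.
  move: dens_lt; rewrite KE -EFinM lte_fin => Ks.
  have lim_up : n.+1%:R * K * (1 + e) ^+ n @[e --> 0^'+] --> n.+1%:R * K.
    rewrite [X in _ --> X](_ : _ = n.+1%:R * K * (1 + 0) ^+ n); last first.
      by rewrite addr0 expr1n mulr1.
    apply: cvg_at_right_filter; apply: cvgM; first exact: cvg_cst.
    by apply: cvg_exprn; apply: cvgD; [exact: cvg_cst|exact: cvg_id].
  near=> e.
  have e0 : 0 < e by near: e; exact: nbhs_right_gt.
  have e1 : e < 1 by near: e; exact: nbhs_right_lt.
  have s_ge : n.+1%:R * K * (1 + e) ^+ n <= s.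
    by near: e; apply: cvgr_le lim_up _ Ks.
  rewrite inver gt_eqF ?mulr_gt0// lee_pdivrMr ?mulr_gt0//.
  apply: (le_trans (le_nbhd_shell e)).
  have K0 : 0 <= K by rewrite -lee_fin -KE.
  apply: (le_trans (shell_le_density K _ _ KE _ _)); [lra|lra|].
  rewrite -EFinM lee_fin.
  have /andP[_ gap] := @exprB_bounds _ (1 - e) (1 + e) n
    ltac:(lra) ltac:(lra).
  apply: (le_trans (ler_wpM2l K0 gap)).
  apply: le_trans (ler_wpM2r _ s_ge); last by rewrite mulr_ge0// ltW.
  by rewrite le_eqVlt; apply/orP; left; apply/eqP; ring.
Unshelve. all: by end_near. Qed.

(** The two degenerate cases follow from the case 0 < a < b.  For a = 0,
    homogeneity gives V(0,b) <= 2^-d V(0,b) + K (b^d - (b/2)^d), which is solved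
    for V(0,b) since this volume is finite; for a = b, let c decrease to a in
    V(a,a) <= V(a,c). *)
Lemma shell_le_density_closed K a b :
  shell_density = K%:E -> 0 <= a -> a <= b ->
  (lebesgue_outer (shell a b) <= (K * (b ^+ n.+1 - a ^+ n.+1))%:E)%E.
Proof.
move=> KE.
have K0 : 0 <= K by rewrite -lee_fin -KE shell_density_ge0.
have from0 c : 0 < c -> (lebesgue_outer (shell 0 c) <= (K * c ^+ n.+1)%:E)%E.
  move=> c0; have half0 : 0 < 2^-1 :> R by rewrite invr_gt0.
  have := shell_subadditive 0 (2^-1 * c) c.
  have := shellZ 2^-1 0 c half0; rewrite mulr0 => ->.
  have := shell_le_density K (2^-1 * c) c KE.
  rewrite mulr_gt0// gtr_pMl// invf_lt1// ltr1n => /(_ erefl erefl).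
  have /fineK <- := shell_fin_num 0 c.
  have /fineK <- := shell_fin_num (2^-1 * c) c.
  rewrite -EFinM -EFinD !lee_fin => upper lower.
  have q1 : 2^-1 ^+ n.+1 < 1 :> R.
    by rewrite exprn_ilt1// ?ltW// invf_lt1// ltr1n.
  rewrite exprMn in upper.
  have : (1 - 2^-1 ^+ n.+1) * fine (lebesgue_outer (shell 0 c)) <=
         (1 - 2^-1 ^+ n.+1) * (K * c ^+ n.+1) by lra.
  by rewrite ler_pM2l// subr_gt0.
have off_diagonal c c' : 0 <= c -> c < c' ->
    (lebesgue_outer (shell c c') <= (K * (c' ^+ n.+1 - c ^+ n.+1))%:E)%E.
  rewrite le_eqVlt => /predU1P[<-|c0 cc']; last exact: shell_le_density.
  by rewrite expr0n subr0; exact: from0.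
move=> a0; rewrite le_eqVlt => /predU1P[<-|]; last exact: off_diagonal.
have lim_diag : K * (c ^+ n.+1 - a ^+ n.+1) @[c --> a^'+] -->
    K * (a ^+ n.+1 - a ^+ n.+1).
  apply: cvg_at_right_filter; apply: cvgM; first exact: cvg_cst.
  by apply: cvgB; [exact: cvg_exprn|exact: cvg_cst].
have /fineK <- := shell_fin_num a a; rewrite lee_fin.
rewrite -(cvg_lim _ lim_diag)//; apply: limr_ge.
  by apply/cvg_ex; exists (K * (a ^+ n.+1 - a ^+ n.+1)).
near=> c; have ac : a < c by near: c; exact: nbhs_right_gt.
rewrite -lee_fin fineK ?shell_fin_num//.
by apply: le_trans (off_diagonal a c a0 ac); apply: le_shell => //; exact: ltW.
Unshelve. all: by end_near. Qed.

Lemma shell_lipschitz K a b r : shell_density = K%:E ->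
  0 <= a -> a <= b -> b <= r ->
  (lebesgue_outer (shell a b) <= (K * n.+1%:R * r ^+ n * (b - a))%:E)%E.
Proof.
move=> KE a0 ab br; apply: (le_trans (shell_le_density_closed K a b KE a0 ab)).
have K0 : 0 <= K by rewrite -lee_fin -KE shell_density_ge0.
rewrite lee_fin -!mulrA ler_wpM2l//.
have /andP[_ /le_trans->//] := exprB_bounds a b n a0 ab.
rewrite -mulrA ler_wpM2l// ler_wpM2r ?subr_ge0//.
by rewrite lerXn2r// nnegrE ?(le_trans a0)// (le_trans ab).
Qed.

(** Integration in polar coordinates, as an inequality: each interval of a
    covering of [E] is clipped to [0, r] and replaced by a shell. *)
Lemma lebesgue_outer_radial K (E : set R) r : shell_density = K%:E ->
  (forall t, E t -> 0 <= t <= r) -> 0 <= r ->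
  (lebesgue_outer [set y : 'rV[R]_n.+1 | E (enorm y)] <=
   (K * n.+1%:R * r ^+ n)%:E * lebesgue_outer (embed_R1 E))%E.
Proof.
move=> KE Er r0; set c := K * _ * _.
have : 0 <= c.
  by rewrite !mulr_ge0// ?exprn_ge0// -lee_fin -KE shell_density_ge0.
rewrite le_eqVlt => /predU1P[c0|c0].
  (* Division by c is impossible, but every shell in [0, r] is null. *)
  rewrite -c0 mul0e.
  apply: (@le_trans _ _ (lebesgue_outer (shell 0 r))).
    by apply: le_lebesgue_outer => y /Er.
  apply: (le_trans (shell_lipschitz K 0 r r KE _ _ _)) => //.
  by rewrite -/c -c0 mul0r.
rewrite -lee_pdivrMl//; apply: le_ereal_inf_tmp => _ [a [b [ab EB ->]]].
rewrite lee_pdivrMl// -nneseriesZl; last first.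
  by move=> k _; rewrite lee_fin box_vol_ge0.
pose slice k : set 'rV[R]_n.+1 :=
  [set y | E (enorm y) /\ a k ord0 ord0 < enorm y <= b k ord0 ord0].
apply: (@le_trans _ _ (lebesgue_outer (\bigcup_k slice k))).
  apply: le_lebesgue_outer => y Ey.
  have /EB[k _ yk] : embed_R1 E (const_mx (enorm y)) by rewrite /embed_R1/= mxE.
  by exists k => //; split => //; have := yk ord0; rewrite mxE.
apply: (le_trans (lebesgue_outer_sigma_subadditive _ _)).
apply: lee_nneseries => [k _ _|k _]; first exact: lebesgue_outer_ge0.
rewrite big_ord1.
have [lohi|hilo] := leP (Num.max (a k ord0 ord0) 0) (Num.min (b k ord0 ord0) r).
  apply: (@le_trans _ _ (lebesgue_outer
      (shell (Num.max (a k ord0 ord0) 0) (Num.min (b k ord0 ord0) r)))).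
    apply: le_lebesgue_outer => y [/Er/andP[y0 yr] /andP[/ltW ay yb]].
    by rewrite /shell/= ge_max le_min ay y0 yb yr.
  apply: (le_trans (shell_lipschitz K _ _ r KE _ lohi _)).
  - by rewrite le_max lexx orbT.
  - by rewrite ge_min lexx orbT.
  - rewrite -EFinM lee_fin -/c ler_wpM2l ?(ltW c0)// lerB//.
      by rewrite ge_min lexx.
    by rewrite le_max lexx.
rewrite (_ : slice k = set0) ?lebesgue_outer0.
  by rewrite -EFinM lee_fin mulr_ge0 ?(ltW c0)// subr_ge0.
apply/seteqP; split => // y [/Er/andP[y0 yr] /andP[/ltW ay yb]].
move: hilo; rewrite ltNge => /negP; apply.
by apply: (@le_trans _ _ (enorm y)); rewrite ?ge_max ?le_min ?ay ?yb ?y0.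
Qed.

End shells.

(** * Upper densities *)

Lemma eball_embed_R1 {R : realType} (D : set R) (r : R) :
  eball 0 r `&` embed_R1 D = embed_R1 (D `&` `]- r, r[%classic).
Proof.
apply/seteqP; split=> t; rewrite /eball /embed_R1 /= sub0r enormN
  /enorm big_ord1 sqrtr_sqr in_itv/= ltr_norml.
  by move=> [tr Dt].
by move=> [Dt tr].
Qed.

Lemma upper_density_embed_R1 {R : realType} (D : set R) :
  upper_density (embed_R1 D) =
  limf_esup (fun r : R =>
    (lebesgue_measure (D `&` `](- r)%R, r[)%classic / r%:E)%E) (pinfty_nbhs R).
Proof.
rewrite /upper_density; congr (limf_esup _ _); apply/funext => r.
by rewrite expr1 eball_embed_R1 lebesgue_outer_embed_R1.
Qed.

Lemma upper_density_ge0 {R : realType} (n : nat) (A : set 'rV[R]_n.+1) :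
  (0 <= upper_density A)%E.
Proof.
apply: limf_esup_ge0 => [|r]; first exact: filter_not_empty.
have [r0|r0] := leP r 0; last first.
  by rewrite mule_ge0 ?lebesgue_outer_ge0// inve_ge0 lee_fin exprn_ge0// ltW.
rewrite (_ : eball 0 r `&` A = set0) ?lebesgue_outer0 ?mul0e//.
apply/seteqP; split => // y [+ _]; rewrite /eball/=.
move=> /(le_lt_trans (enorm_ge0 _)).
by rewrite ltNge r0.
Qed.

(** The case c = 0 is covered even if the upper limit of [g] is infinite, with
    the convention +oo * 0 = 0: the hypothesis then says that [f] is eventually
    nonpositive. *)
Lemma limf_esup_shift_le {R : realType} (f g : R -> \bar R) (c s : R) :
  0 <= c ->
  (\forall r \near +oo, (f r <= g (r + s)%R * c%:E)%E) ->
  (limf_esup f (pinfty_nbhs R) <= limf_esup g (pinfty_nbhs R) * c%:E)%E.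
Proof.
move=> c0 fg.
have le_sup (V : set R) : (\forall r \near +oo, V (r + s)) ->
    (limf_esup f (pinfty_nbhs R) <= ereal_sup (g @` V) * c%:E)%E.
  move=> Vs; apply: (@le_trans _ _ (ereal_sup (f @`
      [set r | (f r <= g (r + s)%R * c%:E)%E /\ V (r + s)]))).
    apply: ereal_inf_lbound; eexists; last by [].
    exact: filterI.
  apply: ge_ereal_sup => _ [r [fr Vr] <-]; apply: (le_trans fr).
  apply: lee_wpmul2r; rewrite ?lee_fin//.
  by apply: ereal_sup_ubound; exists (r + s).
move: c0; rewrite le_eqVlt => /predU1P[c0|c0].
  have := le_sup setT; rewrite -c0 !mule0; apply; exact: filterT.
rewrite -lee_pdivrMr//; apply: le_ereal_inf_tmp => _ [V [M [Mreal VM]] <-].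
rewrite lee_pdivrMr//; apply: le_sup.
near=> r; apply: VM; rewrite -ltrBlDr; near: r; apply: nbhs_pinfty_gt.
exact: num_real.
Unshelve. all: by end_near. Qed.

(** Centred at [x], the set A `&` B(0,r) lies over the part of the pinned
    distance set below r + |x|, by the triangle inequality. *)
Lemma ball_slice_bound {R : realType} (n : nat) (A : set 'rV[R]_n.+1)
    (x : 'rV[R]_n.+1) (K r : R) : @shell_density R n = K%:E -> 0 < r ->
  (lebesgue_outer (eball 0 r `&` A) <=
   (K * n.+1%:R * (r + enorm x) ^+ n)%:E * lebesgue_outer
     (eball 0 (r + enorm x)%R `&` embed_R1 (pinned_distance_set x A)))%E.
Proof.
move=> KE r0; set s := enorm x; have s0 : 0 <= s := enorm_ge0 x.
have K0 : 0 <= K by rewrite -lee_fin -KE shell_density_ge0.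
pose E := [set t | pinned_distance_set x A t /\ t < r + s].
have Er t : E t -> 0 <= t <= r + s.
  by move=> [[y Ay <-] /ltW ->]; rewrite enorm_ge0.
apply: (@le_trans _ _ (lebesgue_outer [set y : 'rV[R]_n.+1 | E (enorm y)])).
  rewrite -[leRHS]mul1e -(expr1n _ n.+1).
  apply: (@lebesgue_outer_affine _ _ 1 x) => //.
  move=> y; rewrite scale1r => -[yr Ay].
  have yE : enorm (x - (y + x)) = enorm y.
    by rewrite opprD addrCA subrr addr0 enormN.
  split; first by exists (y + x).
  have := ler_enormD (y + x) (- x); rewrite addrK.
  by rewrite enormN; move: yr; rewrite /eball/= sub0r enormN -/s; lra.
apply: le_trans (lebesgue_outer_radial K E (r + s) KE Er _) _.
  by rewrite addr_ge0// ltW.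
apply: lee_wpmul2l.
  by rewrite lee_fin !mulr_ge0// exprn_ge0// addr_ge0// ltW.
rewrite eball_embed_R1; apply: le_lebesgue_outer => t [Dt tr]; split => //=.
have := Er _ (conj Dt tr); rewrite in_itv/= tr => /andP[t0 _].
by rewrite andbT; lra.
Qed.

(** The quotient ((r + s) / r)^d tends to 1; the bound 2 is what the factor 2 of
    the theorem provides for. *)
Lemma near_shifted_power_le {R : realType} (n : nat) (s : R) : 0 <= s ->
  \forall r \near +oo, (r + s) ^+ n.+1 <= 2 * r ^+ n.+1.
Proof.
move=> s0; near=> r.
have r0 : 0 < r by near: r; apply: nbhs_pinfty_gt; exact: num_real.
have rs : s <= r by near: r; apply: nbhs_pinfty_ge; exact: num_real.
(* For s <= r, the increment (r + s)^d - r^d is at most d (2r)^(d-1) s. *)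
have rbig : n.+1%:R * 2 ^+ n * s <= r.
  by near: r; apply: nbhs_pinfty_ge; exact: num_real.
have /andP[_] := @exprB_bounds _ r (r + s) n ltac:(lra) ltac:(lra).
rewrite addrAC subrr add0r.
have : n.+1%:R * (r + s) ^+ n * s <= r ^+ n.+1.
  apply: (@le_trans _ _ (n.+1%:R * (2 * r) ^+ n * s)).
    apply: ler_wpM2r => //; apply: ler_wpM2l => //.
    by apply: lerXn2r; rewrite ?nnegrE; lra.
  rewrite exprMn exprS.
  rewrite [leLHS](_ : _ = n.+1%:R * 2 ^+ n * s * r ^+ n); last by ring.
  by apply: ler_wpM2r => //; rewrite exprn_ge0// ltW.
by lra.
Unshelve. all: by end_near. Qed.

Theorem theorem1 (R : realType) (d : nat) (hd : (2 <= d)%N)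
    (A : set 'rV[R]_d) (mA : lebesgue_measurable A)
    (A_gt0 : (0 < upper_density A)%E) (x : 'rV[R]_d) :
  upper_density (embed_R1 (pinned_distance_set x A)) =
    limf_esup
      (fun r : R =>
         (lebesgue_measure (pinned_distance_set x A `&` `](- r)%R, r[)%classic
            / r%:E)%E)
      (pinfty_nbhs R)
  /\ (upper_density (embed_R1 (pinned_distance_set x A)) >=
      upper_density A / (2%:E * surface_area (unit_sphere R d)))%E.
Proof.
split; first exact: upper_density_embed_R1.
case: d hd A mA A_gt0 x => [//|n] _ A _ A_gt0 x.
set D := pinned_distance_set x A.
rewrite surface_area_unit_sphere.
have d0 : 0 < n.+1%:R :> R by [].
have := @shell_density_ge0 R n.
case KE : shell_density => [K| |]// K0; last first.
  (* If K is infinite, the claimed lower bound is zero. *)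
  rewrite gt0_muley ?lte_fin// gt0_muley ?lte_fin// invey mule0.
  exact: upper_density_ge0.
rewrite lee_fin in K0.
(* Stated as a product, so that it makes sense for K = 0, which it excludes. *)
have main : (upper_density A <=
    upper_density (embed_R1 D) * (2 * (n.+1%:R * K))%:E)%E.
  apply: (@limf_esup_shift_le _ _ _ _ (enorm x)).
    by rewrite !mulr_ge0// ltW.
  near=> r.
  have r0 : 0 < r by near: r; apply: nbhs_pinfty_gt; exact: num_real.
  have rs0 : 0 < r + enorm x by rewrite ltr_wpDr// enorm_ge0.
  rewrite !inver !gt_eqF ?exprn_gt0// lee_pdivrMr ?exprn_gt0//.
  apply: le_trans (ball_slice_bound n A x K r KE r0) _.
  rewrite muleC -!muleA; apply: lee_wpmul2l; first exact: lebesgue_outer_ge0.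
  rewrite -!EFinM lee_fin expr1 ler_pdivlMl//.
  rewrite [leLHS](_ : _ = K * n.+1%:R * (r + enorm x) ^+ n.+1); last first.
    by rewrite exprS; ring.
  rewrite [leRHS](_ : _ = K * n.+1%:R * (2 * r ^+ n.+1)); last by ring.
  apply: ler_wpM2l; first by rewrite mulr_ge0// ltW.
  by near: r; apply: near_shifted_power_le; exact: enorm_ge0.
have {}K0 : 0 < K.
  rewrite lt_def K0 andbT; apply/eqP => K0'; move: main.
  by rewrite K0' !mulr0 mule0 leNgt A_gt0.
rewrite -!EFinM inver gt_eqF ?mulr_gt0// lee_pdivrMr// ?mulr_gt0//.
Unshelve. all: by end_near. Qed.
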